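(* Let $X, Y$ be smooth Banach spaces and let $T\in B(X,Y)$ have closed range. Let $\delta T\in B(X,Y)$ and put $\bar T=T+\delta T$. Assume that $\mathcal N(T)$ and $\mathcal N(\bar T)$ are Chebyshev subspaces of $X$ and that $\mathcal R(T)$ and $\mathcal R(\bar T)$ are Chebyshev subspaces of $Y$. Then the Moore--Penrose metric generalized inverse $T^M$ of $T$ exists. If, in addition, $T^M$ is quasi-additive on $\mathcal R(\delta T)$ and $I_X+T^M\delta T$ is invertible in $B(X,X)$, then $$\Phi=T^M(I_Y+\delta T\,T^M)^{-1}=(I_X+T^M\delta T)^{-1}T^M$$ is well defined (i.e. $I_Y+\delta T\,T^M$ is invertible in $H(Y,Y)$ and the two expressions coincide), and the following statements are equivalent: (1) $\Phi$ is the Moore--Penrose metric generalized inverse of $\bar T$, i.e. $\Phi=\bar T^M$; (2) $\mathcal R(\bar T)=\mathcal R(T)$ and $\mathcal N(\bar T)=\mathcal N(T)$; (3) $\mathcal R(\delta T)\subset\mathcal R(T)$ and $\mathcal N(T)\subset\mathcal N(\delta T)$.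
   Context: $B(X,Y)$ is the space of bounded linear operators from $X$ to $Y$; $\mathcal N(\cdot)$ and $\mathcal R(\cdot)$ denote null space and range. A map $A:X\to Y$ is a bounded homogeneous operator if it maps bounded sets to bounded sets and $A(\lambda x)=\lambda A(x)$ for all $x\in X$, $\lambda\in\mathbb R$; $H(X,Y)$ is the set of all such maps. An element of $H(Y,Y)$ is invertible in $H(Y,Y)$ if it is bijective with inverse in $H(Y,Y)$. A map $A:Y\to X$ is quasi-additive on a subset $M\subset Y$ if $A(y+z)=A(y)+A(z)$ for all $y\in Y$, $z\in M$. A Banach space is smooth if for each unit vector $x$ there is a unique norm-one functional $f$ with $f(x)=1$. A subspace $G$ of a Banach space $Z$ is Chebyshev if each $z\in Z$ has exactly one nearest point in $G$; this nearest point is denoted $\pi_G(z)$ and $\pi_G:Z\to G$ is called the metric projector onto $G$. For $T\in B(X,Y)$ with $\mathcal N(T)$ Chebyshev in $X$ and $\mathcal R(T)$ Chebyshev in $Y$, a Moore--Penrose metric generalized inverse of $T$ is a bounded homogeneous operator $T^M\in H(Y,X)$ with $TT^MT=T$, $T^MTT^M=T^M$, $T^MT=I_X-\pi_{\mathcal N(T)}$, $TT^M=\pi_{\mathcal R(T)}$; it is unique when it exists. Products of operators denote composition. If $T^M$ is quasi-additive on $\mathcal R(\delta T)$, then $T^M\delta T$ is a bounded linear operator on $X$. *)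

(* Defs.v *)
Set Warnings "-notation-overridden,-notation-incompatible-prefix,-ambiguous-paths".
From mathcomp Require Import all_boot all_order all_algebra.
From mathcomp Require Import all_classical all_reals all_analysis.
Set Implicit Arguments.
Unset Strict Implicit.
Unset Printing Implicit Defensive.
Import Order.TTheory GRing.Theory Num.Theory.
Import numFieldNormedType.Exports.
Local Open Scope classical_set_scope.
Local Open Scope ring_scope.

Section operators.
Context {R : realType} {X Y : normedModType R}.
Implicit Types (f : X -> Y) (A : Y -> X).

(* B(X, Y); for a linear map, [bounded_fun_norm] (bounded on each ball) is
   boundedness in the usual sense and amounts to continuity. *)
Definition bounded_linear f : Prop := linear f /\ bounded_fun_norm f.

(* H(X, Y) *)
Definition bounded_homogeneous f : Prop := bounded_fun_norm f /\ scalable f.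

Definition nullspace f : set X := f @^-1` [set 0].

Definition quasi_additive A (M : set Y) : Prop :=
  forall y z, M z -> A (y + z) = A y + A z.

(* The inverse of a bijection; the default value 0 is then never used. *)
Definition inverse_map f : Y -> X := 'pinv_(fun=> 0) [set: X] f.

Lemma inverse_mapK f : bijective f -> cancel f (inverse_map f).
Proof.
by move=> fb x; apply: pinvKV; rewrite ?inE// => u v _ _; exact: bij_inj.
Qed.

Lemma inverse_mapVK f : bijective f -> cancel (inverse_map f) f.
Proof. by case=> g fK gK y; rewrite -[y in LHS]gK inverse_mapK//; exists g. Qed.

Definition opnorm f : R := sup [set `|f x| | x in [set x | `|x| <= 1]].

End operators.

Definition invertible_B {R : realType} {X : normedModType R} (f : X -> X) :=
  [/\ bounded_linear f, bijective f & bounded_linear (inverse_map f)].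

Definition invertible_H {R : realType} {X : normedModType R} (f : X -> X) :=
  [/\ bounded_homogeneous f, bijective f & bounded_homogeneous (inverse_map f)].

Definition smooth_space {R : realType} (X : normedModType R) : Prop :=
  forall x : X, `|x| = 1 ->
    exists! f : X -> R^o, [/\ bounded_linear f, opnorm f = 1 & f x = 1].

Section metric_projection.
Context {R : realType} {Z : normedModType R}.
Implicit Types G : set Z.

Definition linear_subspace G : Prop :=
  G 0 /\ forall (a : R) u v, G u -> G v -> G (a *: u + v).

Definition nearest G (z : Z) : set Z :=
  [set g | G g /\ forall h, G h -> `|z - g| <= `|z - h|].

Definition is_chebyshev G : Prop :=
  linear_subspace G /\ forall z, exists! g, nearest G z g.

(* Meaningful when G is Chebyshev; 0 at the points without a nearest point. *)
Definition metric_proj G (z : Z) : Z := xget 0 (nearest G z).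

Lemma metric_projP G z : is_chebyshev G -> nearest G z (metric_proj G z).
Proof. by case=> _ /(_ z)[g [gP _]]; apply: (xgetPex 0); exists g. Qed.

End metric_projection.

(* A is T^M; used only when the null space and the range of T are Chebyshev. *)
Definition MP_metric_inverse {R : realType} {X Y : normedModType R}
    (T : X -> Y) (A : Y -> X) : Prop :=
  [/\ bounded_homogeneous A,
      T \o A \o T = T,
      A \o T \o A = A,
      A \o T = id \- metric_proj (nullspace T) &
      T \o A = metric_proj (range T)].

(* Main.v *)
(* Existence: the open mapping theorem lifts pi_R(T) y to some x with
   |x| <= C |y|, and T^M y := x - pi_N(T) x does not depend on the lift.

   Write A = T^M and S = (I + A dT)^-1.  Quasi-additivity of A on R(dT) makes
   I - dT S A the inverse of I + dT A, whence Phi = S A.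

   (1) => (2): Phi and A have the same range and the same kernel.  The kernel of
   a metric generalized inverse is the zero set of the metric projector onto the
   range of the operator, and its range is the zero set of the metric projector
   onto the null space.  In a smooth space this zero set determines the
   subspace: z is in it iff the unique norming functional of z vanishes on the
   subspace, by Hahn-Banach.

   (3) => (1): then T + dT = T (I + A dT) has the range and null space of T. *)
Require Import Defs.
Set Warnings "-notation-overridden,-notation-incompatible-prefix,-ambiguous-paths".
From mathcomp Require Import all_boot all_order all_algebra.
From mathcomp Require Import all_classical all_reals all_analysis.
From mathcomp Require Import ring lra.
Import Order.TTheory GRing.Theory Num.Theory.
Import numFieldNormedType.Exports.
Local Open Scope classical_set_scope.
Local Open Scope ring_scope.

Lemma linear_at0 {R : pzRingType} {U : lmodType R} {V : zmodType}
    {s : GRing.Scale.law R V} {f : U -> V} : linear_for s f -> f 0 = 0.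
Proof. by move=> /zmod_morphism_linear/(_ 0 0); rewrite !subrr. Qed.

(** * Metric projectors onto Chebyshev subspaces *)

Section metric_proj_theory.
Context {R : realType} {Z : normedModType R}.
Variable G : set Z.
Hypothesis G_chebyshev : is_chebyshev G.

Let G0 : G 0. Proof. by case: G_chebyshev => -[]. Qed.

Lemma chebyshevD u v : G u -> G v -> G (u + v).
Proof.
by case: G_chebyshev => -[_ GD] _ Gu Gv; rewrite -[u]scale1r; exact: GD.
Qed.

Lemma chebyshevZ a u : G u -> G (a *: u).
Proof.
by case: G_chebyshev => -[_ GD] _ Gu; rewrite -[_ *: _]addr0; exact: GD.
Qed.

Lemma chebyshevB u v : G u -> G v -> G (u - v).
Proof. by move=> Gu Gv; rewrite -scaleN1r; apply/chebyshevD/chebyshevZ. Qed.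

Lemma metric_proj_mem z : G (metric_proj G z).
Proof. by case: (metric_projP z G_chebyshev). Qed.

Lemma metric_proj_le z h : G h -> `|z - metric_proj G z| <= `|z - h|.
Proof. by case: (metric_projP z G_chebyshev) => _; exact. Qed.

Lemma metric_proj_unique z g : nearest G z g -> metric_proj G z = g.
Proof.
case: G_chebyshev => _ /(_ z)[g0 [_ g0_uniq]] zg.
by rewrite -(g0_uniq _ zg) -(g0_uniq _ (metric_projP z G_chebyshev)).
Qed.

Lemma metric_projZ a z : metric_proj G (a *: z) = a *: metric_proj G z.
Proof.
apply: metric_proj_unique; split; first exact/chebyshevZ/metric_proj_mem.
move=> h Gh; have [->|a0] := eqVneq a 0.
  by rewrite !scale0r subr0 normr0.
rewrite -[h](scalerKV a0) -!scalerBr !normrZ ler_wpM2l//.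
exact/metric_proj_le/chebyshevZ.
Qed.

(** Translation by an element of [G] preserves both [G] and distances. This is the only additivity
    of the projector that the development uses. *)
Lemma metric_projDr z g : G g -> metric_proj G (z + g) = metric_proj G z + g.
Proof.
move=> Gg; apply: metric_proj_unique; split.
  exact/chebyshevD/Gg/metric_proj_mem.
move=> h Gh; rewrite opprD addrACA subrr addr0.
rewrite -addrA -(opprB h g).
exact/metric_proj_le/chebyshevB.
Qed.

Lemma metric_proj0 : metric_proj G 0 = 0.
Proof. by have := metric_projZ 0 0; rewrite !scale0r. Qed.

Lemma metric_proj_id g : G g -> metric_proj G g = g.
Proof.
by move=> Gg; rewrite -[g in LHS]add0r metric_projDr// metric_proj0 add0r.
Qed.

Lemma metric_proj_res z : metric_proj G (z - metric_proj G z) = 0.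
Proof.
have GN : G (- metric_proj G z).
  by rewrite -scaleN1r; exact/chebyshevZ/metric_proj_mem.
by rewrite metric_projDr// subrr.
Qed.

Lemma norm_sub_metric_proj z : `|z - metric_proj G z| <= `|z|.
Proof. by rewrite -[z in leRHS]subr0; exact: metric_proj_le. Qed.

Lemma norm_metric_proj z : `|metric_proj G z| <= 2 * `|z|.
Proof.
rewrite -[metric_proj G z](subKr z) (le_trans (ler_normB _ _))//.
by have := norm_sub_metric_proj z; lra.
Qed.

End metric_proj_theory.

(** * Hahn-Banach for sublinear functionals, by Zorn's lemma *)

Section hahn_banach.
Context {R : realType} {Z : lmodType R}.
Implicit Types p q : Z -> R.

Definition sublinear p : Prop :=
  (forall x y, p (x + y) <= p x + p y) /\
  (forall a x, 0 <= a -> p (a *: x) = a * p x).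

Lemma sublinear0 {p} : sublinear p -> p 0 = 0.
Proof. by case=> _ /(_ 0 0 (lexx _)); rewrite scale0r mul0r. Qed.

Lemma sublinear_geN {p} x : sublinear p -> - p (- x) <= p x.
Proof.
move=> p_sub; have := p_sub.1 x (- x).
by rewrite subrr sublinear0//; lra.
Qed.

(** Applying the inequality to [a^-1] and [a *: x] yields its converse, so an infimum needs only one
    estimate. *)
Lemma sublinear_homo p : (forall x y, p (x + y) <= p x + p y) -> p 0 = 0 ->
  (forall a x, 0 < a -> p (a *: x) <= a * p x) -> sublinear p.
Proof.
move=> pD p0 pZ; split=> // a x; rewrite le_eqVlt => /predU1P[<-|a0].
  by rewrite scale0r mul0r.
apply/eqP; rewrite eq_le pZ//= -ler_pdivlMl//.
rewrite -[x in leLHS](scalerK (lt0r_neq0 a0)).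
by rewrite pZ// invr_gt0.
Qed.

Lemma inf_le_mem (E : set R) x m :
  (forall y, E y -> m <= y) -> E x -> inf E <= x.
Proof. by move=> mE Ex; apply: ge_inf => //; exists m. Qed.

(* Witness: q' x = inf over t >= 0 of q (x + t a) - t q a. *)
Lemma sublinear_slide {q} a : sublinear q ->
  exists q', [/\ sublinear q', (forall x, q' x <= q x) & q' (- a) <= - q a].
Proof.
move=> q_sub; have [qD qZ] := q_sub.
pose E x := [set q (x + t *: a) - t * q a | t in [set t : R | 0 <= t]].
(* Subadditivity at [- x] and [x + t *: a], whose sum is [t *: a], keeps the infimum finite. *)
have E_lb x y : E x y -> - q (- x) <= y.
  move=> [t /= t0 <-]; rewrite lerBrDr -qZ//.
  have := qD (- x) (x + t *: a); rewrite addKr; lra.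
have E_mem x t : 0 <= t -> E x (q (x + t *: a) - t * q a) by exists t.
have E_le x t : 0 <= t -> inf (E x) <= q (x + t *: a) - t * q a.
  by move=> t0; apply: inf_le_mem (E_lb x) _; exact: E_mem.
have E_glb x m : (forall t, 0 <= t -> m <= q (x + t *: a) - t * q a) ->
    m <= inf (E x).
  move=> mE; apply: lb_le_inf.
    by exists (q (x + 0 *: a) - 0 * q a); exact: E_mem.
  by move=> _ [t /= t0 <-]; exact: mE.
have E_q x : inf (E x) <= q x.
  by have := E_le x 0 (lexx _); rewrite scale0r addr0 mul0r subr0.
exists (fun x => inf (E x)); split=> //.
- apply: sublinear_homo.
  + move=> x y; rewrite -lerBlDr; apply: (E_glb) => t t0.
    rewrite lerBlDr [leRHS]addrC -lerBlDr; apply: (E_glb) => s s0.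
    rewrite lerBlDr (le_trans (E_le _ _ (addr_ge0 s0 t0)))//.
    have := qD (y + s *: a) (x + t *: a).
    rewrite addrACA -scalerDl [y + x]addrC mulrDl; lra.
  + apply/eqP; rewrite eq_le -{1}(sublinear0 q_sub) E_q/=.
    by apply: (E_glb) => t t0; rewrite add0r qZ// subrr.
  + move=> b x b0; rewrite -ler_pdivrMl//; apply: (E_glb) => t t0.
    have b0' := ltW b0.
    rewrite ler_pdivrMl// mulrBr -(qZ b)// scalerDr scalerA mulrA.
    exact/E_le/mulr_ge0.
- have := E_le (- a) 1 ler01; rewrite scale1r addNr sublinear0//; lra.
Qed.

(** Zorn's lemma applies because the pointwise infimum of a chain is again sublinear; [- p (- x)]
    bounds it below. *)
Lemma sublinear_minimal {p} : sublinear p ->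
  exists q, [/\ sublinear q, (forall x, q x <= p x) &
    forall q', sublinear q' -> (forall x, q' x <= q x) -> q' = q].
Proof.
move=> p_sub.
pose S := {q : Z -> R | sublinear q /\ forall x, q x <= p x}.
(* The order is reversed, so that a maximal element is a minimal functional. *)
pose ge (s t : S) := `[< forall x, sval t x <= sval s x >].
have [||||[q [q_sub qp]] q_min] := @Zorn S ge.
- by move=> s; apply/asboolP.
- move=> r s t /asboolP rs /asboolP st; apply/asboolP => x.
  exact: le_trans (st x) (rs x).
- move=> [s sP] [t tP] /asboolP/= st /asboolP/= ts; apply: eq_exist.
  by apply/funext => x; apply/eqP; rewrite eq_le ts st.
- move=> A A_total; have [[s0 As0]|A0] := pselect (A !=set0); last first.
    have pP : sublinear p /\ forall x, p x <= p x by split.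
    by exists (exist _ p pP) => s As; case: A0; exists s.
  pose E x := [set sval s x | s in A].
  have E_lb x y : E x y -> - p (- x) <= y.
    move=> [[s [s_sub sp]] _ <-] /=.
    by apply: le_trans (sublinear_geN _ s_sub); rewrite lerN2.
  have E_le x s : A s -> inf (E x) <= sval s x.
    by move=> As; apply: inf_le_mem (E_lb x) _; exists s.
  have E_glb x m : (forall s, A s -> m <= sval s x) -> m <= inf (E x).
    move=> mE; apply: lb_le_inf; first by exists (sval s0 x); exists s0.
    by move=> _ [s As <-]; exact: mE.
  have infP : sublinear (fun x => inf (E x)) /\ forall x, inf (E x) <= p x.
    split; last first.
      by move=> x; apply: le_trans (E_le x s0 As0) _; case: s0 {As0} => ? [].
    apply: sublinear_homo.
    + move=> x y; rewrite -lerBlDr; apply: (E_glb) => s As.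
      rewrite lerBlDr [leRHS]addrC -lerBlDr.
      apply: (E_glb) => t At; rewrite lerBlDr.
      have [/asboolP st|/asboolP ts] := A_total _ _ As At.
        have := (svalP t).1.1 x y; have := E_le (x + y) t At.
        by have := st x; lra.
      have := (svalP s).1.1 x y; have := E_le (x + y) s As.
      by have := ts y; lra.
    + apply/eqP; rewrite eq_le; apply/andP; split.
        by rewrite -[leRHS](sublinear0 (svalP s0).1); exact: E_le.
      by apply: (E_glb) => s As; rewrite (sublinear0 (svalP s).1).
    + move=> b x b0; rewrite -ler_pdivrMl//; apply: (E_glb) => s As.
      by rewrite ler_pdivrMl// -(svalP s).1.2; [exact: E_le|exact: ltW].
  exists (exist _ (fun x => inf (E x)) infP) => s As.
  by apply/asboolP => x /=; exact: E_le.
exists q; split=> // q' q'_sub q'q.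
have q'P : sublinear q' /\ forall x, q' x <= p x.
  by split=> // x; exact: le_trans (q'q x) (qp x).
have q'E : exist _ q' q'P = exist _ q (conj q_sub qp) :> S.
  by apply: q_min; apply/asboolP.
exact: (congr1 sval q'E).
Qed.

(** A minimal sublinear functional cannot be lowered by sliding along any [x], which makes it odd
    and hence linear. One initial slide along [z] forces the value [p z] at [z]. *)
Lemma hahn_banach_sublinear {p} z : sublinear p ->
  exists f : Z -> R, [/\ scalar f,
    forall x, f x <= p x & f z = p z].
Proof.
move=> /(sublinear_slide z)[p' [p'_sub p'p p'z]].
have [f [f_sub fp' f_min]] := sublinear_minimal p'_sub.
have fN x : f (- x) = - f x.
  have [f' [f'_sub f'f f'x]] := sublinear_slide x f_sub.
  rewrite (f_min f' f'_sub f'f) in f'x.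
  by apply/eqP; rewrite eq_le f'x/= lerNl sublinear_geN.
have fD x y : f (x + y) = f x + f y.
  apply/eqP; rewrite eq_le f_sub.1/=.
  by have := f_sub.1 (x + y) (- y); rewrite addrK fN; lra.
exists f; split.
- move=> a u v; rewrite fD; congr (_ + _).
  have [a0|/ltW a0] := leP 0 a; first exact: f_sub.2.
  by rewrite -[u]opprK scalerN -scaleNr f_sub.2 ?oppr_ge0// fN mulrNN opprK.
- by move=> x; exact: le_trans (fp' x) (p'p x).
- apply/eqP; rewrite eq_le (le_trans (fp' z))//=.
  by rewrite -lerN2 -fN (le_trans (fp' _)).
Qed.

End hahn_banach.

(** * Norming functionals and recovery of a subspace from its projector's zeros *)

Section smooth.
Context {R : realType} {Z : normedModType R}.
Implicit Types (G H : set Z) (f : Z -> R).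

(** This function is the distance to [G]; the sum of the nearest points of [x] and [y] competes for
    [x + y]. *)
Lemma sublinear_dist {G} : is_chebyshev G ->
  sublinear (fun x => `|x - metric_proj G x|).
Proof.
move=> G_cheb; split=> [x y|a x a0].
  have Gxy := chebyshevD _ G_cheb _ _
    (metric_proj_mem _ G_cheb x) (metric_proj_mem _ G_cheb y).
  rewrite (le_trans (metric_proj_le _ G_cheb _ _ Gxy))//.
  by rewrite opprD addrACA ler_normD.
by rewrite metric_projZ// -scalerBr normrZ ger0_norm.
Qed.

(** Hahn-Banach is applied below the distance to [G]: it is at most the norm, vanishes on [G], and
    equals the norm at [z] because [z] projects to 0. *)
Lemma annihilating_norming_functional {G z} : is_chebyshev G ->
  metric_proj G z = 0 ->
  exists f : Z -> R, [/\ scalar f,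
    forall x, `|f x| <= `|x|, f z = `|z| & forall g, G g -> f g = 0].
Proof.
move=> G_cheb Gz.
have [f [f_lin fp fz]] := hahn_banach_sublinear z (sublinear_dist G_cheb).
have fN x : f (- x) = - f x.
  by rewrite -scaleN1r (scalable_linear f_lin) /= mulN1r.
exists f; split=> //.
- move=> x; rewrite ler_norml (le_trans (fp x)) ?norm_sub_metric_proj//.
  rewrite andbT lerNl -fN (le_trans (fp _))//.
  by rewrite -[leRHS]normrN norm_sub_metric_proj.
- by rewrite fz Gz subr0.
- have f_le0 g : G g -> f g <= 0.
    by move=> Gg; rewrite (le_trans (fp g))// metric_proj_id// subrr normr0.
  move=> g Gg; apply/eqP; rewrite eq_le f_le0//= -oppr_le0 -fN f_le0//.
  by rewrite -scaleN1r; exact: chebyshevZ.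
Qed.

Lemma opnorm1 (f : Z -> R) z : `|z| = 1 -> f z = 1 ->
  (forall x, `|f x| <= `|x|) -> opnorm (f : Z -> R^o) = 1.
Proof.
move=> z1 fz fle; set E := [set `|f x| | x in [set x | `|x| <= 1]].
have E1 : E 1 by exists z; rewrite /= ?z1// fz normr1.
have ubE : ubound E 1 by move=> _ [x /= x1 <-]; exact: le_trans (fle x) x1.
apply/eqP; rewrite eq_le; apply/andP; split.
  by apply: ge_sup => //; exists 1.
by apply: ub_le_sup => //; exists 1.
Qed.

Lemma smooth_norming_unique {z : Z} {f g} : smooth_space Z -> z != 0 ->
  scalar f ->
  scalar g ->
  (forall x, `|f x| <= `|x|) -> (forall x, `|g x| <= `|x|) ->
  f z = `|z| -> g z = `|z| -> f = g.
Proof.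
move=> Z_smooth z0 f_lin g_lin fle gle fz gz.
have n0 : `|z| != 0 by rewrite normr_eq0.
pose u := `|z|^-1 *: z.
have u1 : `|u| = 1 by rewrite /u normrZ normfV normr_id mulVf.
have [h [_ h_uniq]] := Z_smooth u u1.
have norming k : scalar k ->
    (forall x, `|k x| <= `|x|) -> k z = `|z| -> h = k.
  move=> k_lin kle kz.
  have ku : k u = 1.
    by rewrite /u (scalable_linear k_lin) /= kz mulVf.
  apply: h_uniq; split=> //; last exact: opnorm1 ku kle.
  split; first by move=> a x y; rewrite k_lin.
  by move=> r; exists r => x xr; exact: le_trans (kle x) xr.
by rewrite -(norming f)// -(norming g).
Qed.

(* The unique norming functional of z = h - pi_G h annihilates both G and H,
   hence z. *)
Lemma smooth_chebyshev_subset {G H} : smooth_space Z ->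
  is_chebyshev G -> is_chebyshev H ->
  (forall z, metric_proj G z = 0 -> metric_proj H z = 0) -> H `<=` G.
Proof.
move=> Z_smooth G_cheb H_cheb GH h Hh.
have Gz := metric_proj_res _ G_cheb h.
have [z0|z0] := eqVneq (h - metric_proj G h) 0.
  by rewrite -[h](subrK (metric_proj G h)) z0 add0r; exact: metric_proj_mem.
have [f [f_lin fle fz fG]] := annihilating_norming_functional G_cheb Gz.
have [g [g_lin gle gz gH]] :=
  annihilating_norming_functional H_cheb (GH _ Gz).
have fg := smooth_norming_unique Z_smooth z0 f_lin g_lin fle gle fz gz.
have := zmod_morphism_linear f_lin h (metric_proj G h).
rewrite fz (fG _ (metric_proj_mem _ G_cheb h)) subr0.
by rewrite fg gH// => /normr0P; rewrite (negPf z0).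
Qed.

End smooth.

(** * Bounded linear and bounded homogeneous maps *)

Section bounded_linear_theory.
Context {R : realType} {X Y : normedModType R}.
Implicit Type f : X -> Y.

Lemma linear_add {f} : linear f -> {morph f : u v / u + v}.
Proof. by move=> f_lin u v; have := f_lin 1 u v; rewrite !scale1r. Qed.

Lemma bounded_linear_le {f} : bounded_linear f ->
  exists2 M, 0 < M & forall x, `|f x| <= M * `|x|.
Proof.
move=> [f_lin /(_ 1)[M fM]]; have fZ := scalable_linear f_lin.
(* The bound [M] on the unit ball may be 0; the maximum makes the constant positive. *)
exists (Num.max M 1); first by rewrite lt_max ltr01 orbT.
move=> x; have [->|x0] := eqVneq x 0.
  by rewrite (linear_at0 f_lin) !normr0 mulr0.
have n0 : 0 < `|x| by rewrite normr_gt0.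
have : `|f (`|x|^-1 *: x)| <= M.
  by apply: fM; rewrite normrZ normfV normr_id mulVf// gt_eqF.
rewrite fZ normrZ normfV normr_id ler_pdivrMl// mulrC => /le_trans; apply.
by rewrite ler_wpM2r// le_max lexx.
Qed.

Lemma bounded_linear_homogeneous {f} :
  bounded_linear f -> bounded_homogeneous f.
Proof. by move=> [f_lin f_bnd]; split=> //; exact: scalable_linear. Qed.

End bounded_linear_theory.

Section bounded_homogeneous_theory.
Context {R : realType}.

Lemma bounded_homogeneous_comp {X Y Z : normedModType R}
    {g : Y -> Z} {f : X -> Y} :
  bounded_homogeneous g -> bounded_homogeneous f ->
  bounded_homogeneous (g \o f).
Proof.
move=> [g_bnd gZ] [f_bnd fZ]; split; last by move=> a x; rewrite /= fZ gZ.
move=> r; have [M fM] := f_bnd r; have [N gN] := g_bnd M.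
by exists N => x xr; apply/gN/fM.
Qed.

Lemma bounded_homogeneous_add {X Y : normedModType R} {f g : X -> Y} :
  bounded_homogeneous f -> bounded_homogeneous g ->
  bounded_homogeneous (f \+ g).
Proof.
move=> [f_bnd fZ] [g_bnd gZ]; split; last first.
  by move=> a x; rewrite /= fZ gZ scalerDr.
move=> r; have [M fM] := f_bnd r; have [N gN] := g_bnd r.
exists (M + N) => x xr; rewrite (le_trans (ler_normD _ _))//.
by rewrite lerD ?fM ?gN.
Qed.

Lemma bounded_homogeneous_opp {X Y : normedModType R} {f : X -> Y} :
  bounded_homogeneous f -> bounded_homogeneous (fun x => - f x).
Proof.
move=> [f_bnd fZ]; split; last by move=> a x; rewrite fZ scalerN.
by move=> r; have [M fM] := f_bnd r; exists M => x xr; rewrite normrN fM.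
Qed.

Lemma bounded_homogeneous_id {X : normedModType R} :
  bounded_homogeneous (id : X -> X).
Proof. by split=> // r; exists r. Qed.

Lemma inverse_map_eq {X Y : normedModType R} {f : X -> Y} {g : Y -> X} :
  cancel f g -> cancel g f -> inverse_map f = g.
Proof.
move=> fK gK; have f_bij : bijective f by exists g.
by apply/funext => y; rewrite -[y in LHS]gK inverse_mapK.
Qed.

End bounded_homogeneous_theory.

(** * Open mapping theorem for an operator with closed range *)

Section open_mapping.
Context {R : realType}.

Lemma geometric_half_lt (c : R) {e : R} : 0 < e ->
  exists n, c * 2^-1 ^+ n < e.
Proof.
move=> e0; have c0 : geometric c (2^-1 : R) @ \oo --> 0.
  by apply: cvg_geometric; rewrite ger0_norm ?invf_lt1// ltr1n.
by have [n _ /(_ n (leqnn n))] := cvgr_lt _ c0 _ e0; exists n.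
Qed.

Lemma closed_approx {V : normedModType R} {F : set V} (l : V) : closed F ->
  (forall e, 0 < e -> exists2 y, F y & `|l - y| < e) -> F l.
Proof.
move=> F_closed lF; apply: F_closed => B /nbhs_ballP[e /= e0 eB].
have [y Fy ly] := lF e e0; exists y; split=> //.
by apply: eB; rewrite -ball_normE.
Qed.

(** The increments after [n] telescope to at most [e n], so the sequence is Cauchy. It serves both
    for nested balls, with [e] the radii, and for successive approximation. *)
Lemma telescope_limit {V : completeNormedModType R} (u : nat -> V)
    (e : nat -> R) :
  (forall n, `|u n.+1 - u n| <= e n - e n.+1) -> (forall n, 0 <= e n) ->
  (forall d, 0 < d -> exists n, e n < d) ->
  exists l, forall n, `|l - u n| <= e n.
Proof.
move=> ue e_ge0 e_small.
have u_le n m : (n <= m)%N -> `|u m - u n| <= e n.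
  move=> /subnKC <-; suff: forall k, `|u (n + k)%N - u n| <= e n - e (n + k)%N.
    by move=> /(_ (m - n)%N); have := e_ge0 (n + (m - n))%N; lra.
  elim=> [|k IHk]; first by rewrite addn0 !subrr normr0.
  rewrite addnS -[u _ - u n](subrKA (u (n + k)%N)).
  rewrite (le_trans (ler_normD _ _))//.
  by have := ue (n + k)%N; move: IHk; lra.
have : cvg (u @ \oo).
  apply/cauchy_cvgP/cauchy_exP => d d0; have [n nd] := e_small d d0.
  exists (u n); rewrite /fmapE -ball_normE; exists n => // m /= nm.
  by rewrite distrC; exact: le_lt_trans (u_le n m nm) nd.
rewrite cvg_ex => -[l /cvgrPdist_le ul]; exists l => n.
apply/ler_addgt0Pr => d d0; have [N _ Nd] := ul d d0.
rewrite -(subrKA (u (maxn n N))) (le_trans (ler_normD _ _))// addrC.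
by rewrite lerD ?u_le ?leq_maxl//; apply: Nd; rewrite /= leq_maxr.
Qed.

Section closed_range.
Context {X Y : completeNormedModType R}.
Variable T : X -> Y.
Hypotheses (T_bounded : bounded_linear T) (T_closed : closed (range T)).

Let T_lin : linear T. Proof. by case: T_bounded. Qed.

(* Baire's argument inside the closed subspace R(T), by nested balls. *)
Lemma baire_closed_range : exists n y0 r, [/\ range T y0, 0 < r &
  forall y e, range T y -> `|y - y0| < r -> 0 < e ->
    exists2 x, `|x| <= n%:R & `|y - T x| < e].
Proof.
apply: contrapT => noball.
pose good (y : Y) (r : R) := range T y /\ 0 < r.
have step n (yr : Y * R) : exists yr' : Y * R, good yr.1 yr.2 ->
    [/\ good yr'.1 yr'.2, `|yr'.1 - yr.1| <= yr.2 - yr'.2, yr'.2 <= yr.2 / 2 &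
      forall x, `|x| <= n%:R -> yr'.2 < `|yr'.1 - T x|].
  case: yr => y0 r.
  have [[Ty0 r0]|?] := pselect (good y0 r); last by exists (0, 0).
  suff [y [e [Ty yr e0 yT]]] : exists y e, [/\ range T y, `|y - y0| < r, 0 < e &
      forall x, `|x| <= n%:R -> e <= `|y - T x|].
    (* The slack [r - |y - y0|] keeps the new ball inside the old one; halving [d] makes the
       avoidance of the images strict. *)
    pose d := Num.min e (r - `|y - y0|).
    have d0 : 0 < d by rewrite lt_min e0 subr_gt0.
    have de : d <= e by rewrite ge_min lexx.
    have dr : d <= r - `|y - y0| by rewrite ge_min lexx orbT.
    have := normr_ge0 (y - y0) => n0.
    exists (y, d / 2); split=> /=; [split=> //; lra|lra|lra|].
    by move=> x /yT; lra.
  apply: contrapT => noy; apply: noball.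
  exists n, y0, r; split=> // y e Ty yr e0.
  apply: contrapT => nox; apply: noy; exists y, e; split=> // x xn.
  by rewrite leNgt; apply/negP => ex; apply: nox; exists x.
have [f fP] := choice (fun a : nat * (Y * R) => step a.1 a.2).
pose s := fix s n := if n is m.+1 then f (m, s m) else (0 : Y, 1 : R).
have sP n : good (s n).1 (s n).2.
  elim: n => [|n IHn]; last by case: (fP (n, s n) IHn).
  by split=> //=; exists 0 => //; exact: linear_at0 T_lin.
have s_half n : (s n).2 <= 1 * 2^-1 ^+ n.
  elim: n => [|n IHn]; first by rewrite mulr1.
  have [_ _ + _] := fP (n, s n) (sP n); rewrite exprS /= in IHn *; lra.
have s_small d : 0 < d -> exists n, (s n).2 < d.
  move=> /(geometric_half_lt 1)[n nd]; exists n; exact: le_lt_trans nd.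
have [||l ls] :=
  telescope_limit (fun n => (s n).1) (fun n => (s n).2) _ _ s_small.
- by move=> n; case: (fP (n, s n) (sP n)).
- by move=> n; apply/ltW; case: (sP n).
have [x _ Tx] : range T l.
  apply: closed_approx => // e /s_small[n ne].
  by exists (s n).1; [case: (sP n)|exact: le_lt_trans ne].
(* Stage [n.+1] keeps away from the images of all vectors of norm at most [n], yet its ball contains
   [l], the image of such a vector. *)
pose n := (Num.truncn `|x|).+1.
have xn : `|x| <= n%:R by apply/ltW/truncnS_gt.
have [_ _ _ /(_ x xn)] := fP (n, s n) (sP n).
by rewrite Tx distrC => /lt_le_trans/(_ (ls n.+1)); rewrite ltxx.
Qed.

(** Subtracting approximate preimages of [y0] and of [y0 + t *: y] moves the Baire ball to the
    origin; dividing by [t] then treats any [y]. *)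
Lemma approx_preimage : exists2 K, 0 <= K & forall y e, range T y -> 0 < e ->
  exists2 x, `|x| <= K * `|y| & `|y - T x| < e.
Proof.
have [n [y0 [r [[x0 _ Tx0] r0 near_y0]]]] := baire_closed_range.
(* The difference of the two preimages has norm at most [2 * n%:R], and it is divided by
   [t = r / 2 / |y|], a scale that keeps [y0 + t *: y] within [r] of [y0]. *)
exists (4 * n%:R / r); first by rewrite divr_ge0 ?mulr_ge0// ltW.
move=> y e [xy _ Txy] e0; have [->|y_neq0] := eqVneq y 0.
  by exists 0; rewrite ?normr0 ?mulr0// (linear_at0 T_lin) subrr normr0.
have n0 : 0 < `|y| by rewrite normr_gt0.
pose t := r / 2 / `|y|.
have t0 : 0 < t by rewrite !divr_gt0.
have te0 : 0 < t * e / 2 by rewrite divr_gt0// mulr_gt0.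
have [||//|x1 x1n x1e] := near_y0 (y0 + t *: y) (t * e / 2).
- exists (x0 + t *: xy) => //.
  by rewrite (linear_add T_lin) (scalable_linear T_lin) Tx0 Txy.
- rewrite addrC addKr normrZ gtr0_norm// divfK ?gt_eqF//; lra.
have [||//|x2 x2n x2e] := near_y0 y0 (t * e / 2).
- by exists x0.
- by rewrite subrr normr0.
have xE : T (t^-1 *: (x1 - x2)) = t^-1 *: (T x1 - T x2).
  by rewrite (scalable_linear T_lin) (zmod_morphism_linear T_lin).
exists (t^-1 *: (x1 - x2)).
  rewrite normrZ gtr0_norm ?invr_gt0// ler_pdivrMl//.
  rewrite (_ : t * _ = n%:R + n%:R); last first.
    by rewrite /t; field; rewrite !gt_eqF.
  by rewrite (le_trans (ler_normB _ _))// lerD.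
rewrite xE -[y in ltLHS](scalerK (lt0r_neq0 t0)) -scalerBr normrZ.
rewrite gtr0_norm ?invr_gt0// ltr_pdivrMl//.
rewrite (_ : t *: y - _ = (y0 + t *: y - T x1) - (y0 - T x2)).
  by have := ler_normB (y0 + t *: y - T x1) (y0 - T x2); lra.
rewrite [y0 + _]addrC -[X in _ = X - _]addrA [y0 - T x1]addrC.
by rewrite [in RHS]addrA !opprB addrACA subrr addr0 addrA addrAC.
Qed.

(** Successive approximation: each correction halves the residual, which stays in [range T], and the
    corrections sum to a vector of norm at most [2 * K * |y|]. *)
Lemma open_mapping_closed_range :
  exists2 C, 0 <= C & forall y, range T y ->
    exists2 x, T x = y & `|x| <= C * `|y|.
Proof.
have [K K0 approx] := approx_preimage.
have [M M0 TM] := bounded_linear_le T_bounded.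
have step (y : Y) : exists x, range T y ->
    `|x| <= K * `|y| /\ `|y - T x| <= `|y| / 2.
  have [Ty|?] := pselect (range T y); last by exists 0.
  have [->|y0] := eqVneq y 0.
    by exists 0 => _; rewrite (linear_at0 T_lin) subrr !normr0 mulr0 mul0r.
  have y2 : 0 < `|y| / 2 by rewrite divr_gt0// normr_gt0.
  by have [x xy xe] := approx y _ Ty y2; exists x => _; split=> //; exact: ltW.
have [g gP] := choice step.
exists (2 * K) => [|y [xy _ Txy]]; first by rewrite mulr_ge0.
pose u := fix u n := if n is m.+1 then u m + g (y - T (u m)) else 0.
pose d n := y - T (u n).
have dS n : d n.+1 = d n - T (g (d n)).
  by rewrite /d /= (linear_add T_lin) opprD addrA.
have Td n : range T (d n).
  by exists (xy - u n) => //; rewrite (zmod_morphism_linear T_lin) Txy.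
have d_half n : `|d n| <= `|y| * 2^-1 ^+ n.
  elim: n => [|n IHn]; first by rewrite /d /= (linear_at0 T_lin) subr0 mulr1.
  rewrite dS; have [_] := gP _ (Td n); rewrite exprS; lra.
(* The geometric tail from [n] on of the correction bounds [K * |y| * 2^-1 ^+ n]. *)
pose e n := 2 * K * `|y| * 2^-1 ^+ n.
have [|||x xu] := telescope_limit u e.
- move=> n; rewrite /= addrC addKr -/(d n); have [gK _] := gP _ (Td n).
  rewrite (le_trans gK)// /e exprS.
  have := ler_wpM2l K0 (d_half n); lra.
- by move=> n; rewrite !mulr_ge0// exprn_ge0.
- by move=> c c0; exact: geometric_half_lt.
exists x; last first.
  by have := xu 0%N; rewrite subr0 /e mulr1.
apply/eqP; rewrite -subr_eq0 -normr_le0; apply/ler_addgt0Pr => c c0.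
rewrite add0r.
have [n nc] := geometric_half_lt (M * (2 * K * `|y|) + `|y|) c0.
have -> : T x - y = T (x - u n) - d n.
  by rewrite /d (zmod_morphism_linear T_lin) opprB addrA subrK.
rewrite (le_trans (ler_normB _ _))// (le_trans _ (ltW nc))// mulrDl lerD//.
by rewrite (le_trans (TM _))// -[leRHS]mulrA ler_wpM2l ?xu// ltW.
Qed.

End closed_range.

End open_mapping.

(** * Existence of the Moore-Penrose metric generalized inverse *)

Section generalized_inverse.
Context {R : realType} {X Y : completeNormedModType R}.
Variable T : X -> Y.
Hypotheses (T_bounded : bounded_linear T) (NT_cheb : is_chebyshev (nullspace T))
  (RT_cheb : is_chebyshev (range T)).

Let T_lin : linear T. Proof. by case: T_bounded. Qed.

Lemma MP_metric_inverse_exists : closed (range T) ->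
  exists A, MP_metric_inverse T A.
Proof.
move=> T_closed; have TZ := scalable_linear T_lin.
have [C C0 lift_ex] := open_mapping_closed_range T T_bounded T_closed.
have /choice[g gP] (y : Y) : exists x, range T y -> T x = y /\ `|x| <= C * `|y|.
  have [Ty|?] := pselect (range T y); last by exists 0.
  by have [x Tx xC] := lift_ex y Ty; exists x.
pose N := nullspace T; pose res x := x - metric_proj N x.
pose A y := res (g (metric_proj (range T) y)).
have Tg y : T (g (metric_proj (range T) y)) = metric_proj (range T) y.
  by case: (gP _ (metric_proj_mem _ RT_cheb y)).
have T_res x : T (res x) = T x.
  have := metric_proj_mem _ NT_cheb x; rewrite /nullspace /= => Tp.
  by rewrite (zmod_morphism_linear T_lin) Tp subr0.
(* Two lifts differ by an element of the null space, and the projector commutes with translation by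
   it. *)
have res_eq x x' : T x = T x' -> res x = res x'.
  move=> Txx'; have Nx : N (x - x').
    by rewrite /N /nullspace /= (zmod_morphism_linear T_lin) Txx' subrr.
  rewrite /res -[x](subrK x') [_ - _ + _]addrC metric_projDr//.
  by rewrite opprD addrACA subrr addr0.
have TA y : T (A y) = metric_proj (range T) y by rewrite T_res Tg.
have AT x : A (T x) = res x.
  by apply: res_eq; rewrite Tg metric_proj_id//; exists x.
exists A; split.
- split=> [r|a y].
    exists (C * (2 * r)) => y yr.
    rewrite (le_trans (norm_sub_metric_proj _ NT_cheb _))//.
    have [_] := gP _ (metric_proj_mem _ RT_cheb y) => /le_trans; apply.
    rewrite ler_wpM2l// (le_trans (norm_metric_proj _ RT_cheb _))//.
    by rewrite ler_wpM2l.
  (* The chosen lift [g] need not be homogeneous, but both sides become residuals of lifts of the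
     same point. *)
  rewrite /A [in RHS]/res scalerBr -metric_projZ// -/(res _).
  by apply: res_eq; rewrite TZ !Tg metric_projZ.
- by apply/funext => x /=; rewrite AT T_res.
- apply/funext => y /=; rewrite TA /A metric_proj_id//.
  exact: metric_proj_mem.
- exact/funext.
- exact/funext.
Qed.

End generalized_inverse.

(** * The perturbed operator and the three equivalent conditions *)

Section perturbation.
Context {R : realType} {X Y : normedModType R}.
Variables (T dT : X -> Y) (A : Y -> X).
Hypotheses (T_bounded : bounded_linear T) (dT_bounded : bounded_linear dT).
Hypotheses (NT_cheb : is_chebyshev (nullspace T))
  (NTbar_cheb : is_chebyshev (nullspace (T \+ dT)))
  (RT_cheb : is_chebyshev (range T))
  (RTbar_cheb : is_chebyshev (range (T \+ dT))).
Hypotheses (A_MP : MP_metric_inverse T A) (A_qadd : quasi_additive A (range dT))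
  (IAdT_inv : invertible_B (id \+ (A \o dT))).

Let T_lin : linear T. Proof. by case: T_bounded. Qed.
Let dT_lin : linear dT. Proof. by case: dT_bounded. Qed.
Let A_homo : bounded_homogeneous A. Proof. by case: A_MP. Qed.
Let TA y : T (A y) = metric_proj (range T) y.
Proof. by case: A_MP => _ _ _ _ /(congr1 (@^~ y)). Qed.
Let AT x : A (T x) = x - metric_proj (nullspace T) x.
Proof. by case: A_MP => _ _ _ /(congr1 (@^~ x)). Qed.
Let ATA y : A (T (A y)) = A y.
Proof. by case: A_MP => _ _ /(congr1 (@^~ y)). Qed.

Let S := inverse_map (id \+ (A \o dT)).

Let S_bounded : bounded_linear S. Proof. by case: IAdT_inv. Qed.
Let S_lin : linear S. Proof. by case: S_bounded. Qed.
Let SK x : S (x + A (dT x)) = x.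
Proof. by case: IAdT_inv => _ f_bij _; exact: (inverse_mapK f_bij x). Qed.
Let SVK x : S x + A (dT (S x)) = x.
Proof. by case: IAdT_inv => _ f_bij _; exact: (inverse_mapVK f_bij x). Qed.

Let W y := y - dT (S (A y)).

Let A_dTD y x : A (y + dT x) = A y + A (dT x).
Proof. by apply: A_qadd; exists x. Qed.

(** Quasi-additivity splits [A (W y)] into [A y - A (dT (S (A y)))], where [S] inverts
    [id \+ (A \o dT)]. Linearity of [dT] first absorbs the minus sign, so that the subtracted term
    lies in [range dT]. *)
Let AW y : A (W y) = S (A y).
Proof.
rewrite /W -scaleN1r -(scalable_linear dT_lin) A_dTD (scalable_linear dT_lin).
rewrite A_homo.2 scaleN1r.
by apply/eqP; rewrite subr_eq SVK.
Qed.

Let WK : cancel (id \+ (dT \o A)) W.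
Proof. by move=> y; rewrite /W /= A_dTD SK addrK. Qed.

Let WVK : cancel W (id \+ (dT \o A)).
Proof. by move=> y; rewrite /= AW subrK. Qed.

Lemma inverse_map_perturbation : inverse_map (id \+ (dT \o A)) = W.
Proof. exact: inverse_map_eq WK WVK. Qed.

Let Phi := A \o inverse_map (id \+ (dT \o A)).

Let PhiE y : Phi y = S (A y).
Proof. by rewrite /Phi inverse_map_perturbation /= AW. Qed.

Lemma perturbation_inverseE : Phi = inverse_map (id \+ (A \o dT)) \o A.
Proof. by apply/funext => y; rewrite PhiE. Qed.

Let Phi_homo : bounded_homogeneous Phi.
Proof.
rewrite perturbation_inverseE.
exact: bounded_homogeneous_comp (bounded_linear_homogeneous S_bounded) A_homo.
Qed.

Lemma perturbation_invertible : invertible_H (id \+ (dT \o A)).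
Proof.
have dT_homo := bounded_linear_homogeneous dT_bounded.
split.
- apply: bounded_homogeneous_add bounded_homogeneous_id _.
  exact: bounded_homogeneous_comp.
- by exists W.
- rewrite inverse_map_perturbation.
  apply: bounded_homogeneous_add bounded_homogeneous_id _.
  apply: bounded_homogeneous_opp; apply: bounded_homogeneous_comp dT_homo _.
  by rewrite -/(S \o A) -perturbation_inverseE.
Qed.

Let A0 : A 0 = 0. Proof. by rewrite -(scale0r 0) A_homo.2 scale0r. Qed.
Let S0 : S 0 = 0. Proof. exact: linear_at0 S_lin. Qed.
Let T0 : T 0 = 0. Proof. exact: linear_at0 T_lin. Qed.

Let S_eq0 x : S x = 0 -> x = 0.
Proof. by move=> Sx; rewrite -[x]SVK Sx (linear_at0 dT_lin) A0 addr0. Qed.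

(** [T \o A] is the projector, and [A \o T \o A = A] prevents it from having more zeros than [A]. *)
Let A_eq0 y : A y = 0 <-> metric_proj (range T) y = 0.
Proof.
rewrite -TA; split=> [->|TAy]; first exact: T0.
by rewrite -ATA TAy A0.
Qed.

Lemma MP_perturbation_eq_spaces : smooth_space X -> smooth_space Y ->
  MP_metric_inverse (T \+ dT) Phi ->
  range (T \+ dT) = range T /\ nullspace (T \+ dT) = nullspace T.
Proof.
move=> X_smooth Y_smooth [_ _ PTP PT TP].
have Phi_eq0 y : Phi y = 0 <-> metric_proj (range (T \+ dT)) y = 0.
  rewrite -TP /=; split=> [->|TPy].
    by rewrite T0 (linear_at0 dT_lin) addr0.
  have := congr1 (@^~ y) PTP; rewrite /= => <-.
  by rewrite TPy PhiE A0 S0.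
(* [Phi = S \o A] with [S] injective, so [Phi] and [A] have the same zeros. *)
have range_eq0 y :
    metric_proj (range (T \+ dT)) y = 0 <-> metric_proj (range T) y = 0.
  rewrite -A_eq0 -Phi_eq0 PhiE; split=> [|->//]; exact: S_eq0.
have A_range x : (exists y, A y = x) <-> metric_proj (nullspace T) x = 0.
  split=> [[y <-]|Nx]; last by exists (T x); rewrite AT Nx subr0.
  by rewrite -ATA AT metric_proj_res.
have Phi_range x :
    (exists y, Phi y = x) <-> metric_proj (nullspace (T \+ dT)) x = 0.
  have PTx z := congr1 (@^~ z) PT; rewrite /= in PTx.
  split=> [[y <-]|Nx]; last by exists ((T \+ dT) x); rewrite /= PTx Nx subr0.
  by have := congr1 (@^~ y) PTP; rewrite /= => <-; rewrite PTx metric_proj_res.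
have null_eq0 x : metric_proj (nullspace (T \+ dT)) x = 0 <->
    metric_proj (nullspace T) x = 0.
  (* The ranges agree because [Phi = A \o W] and [A = Phi \o (id \+ (dT \o A))]. *)
  rewrite -A_range -Phi_range; split=> -[y <-].
    by exists (W y); rewrite AW PhiE.
  by exists (y + dT (A y)); rewrite PhiE A_dTD SK.
split; apply/seteqP; split.
- by apply: smooth_chebyshev_subset => // z /range_eq0.
- by apply: smooth_chebyshev_subset => // z /range_eq0.
- by apply: smooth_chebyshev_subset => // z /null_eq0.
- by apply: smooth_chebyshev_subset => // z /null_eq0.
Qed.

(** Both inclusions follow by writing [dT] as the difference of [T \+ dT] and [T]. *)
Lemma eq_spaces_perturbation_subset :
  range (T \+ dT) = range T -> nullspace (T \+ dT) = nullspace T ->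
  range dT `<=` range T /\ nullspace T `<=` nullspace dT.
Proof.
move=> eqR eqN; split=> [_ [x _ <-]|x Tx].
  have [z _ Tz] : range T ((T \+ dT) x) by rewrite -eqR; exists x.
  by exists (z - x) => //; rewrite (zmod_morphism_linear T_lin) Tz addrC addKr.
have : nullspace (T \+ dT) x by rewrite eqN.
by rewrite /nullspace /= in Tx *; rewrite Tx add0r.
Qed.

(* Under these inclusions, T + dT = T (I + A dT). *)
Lemma perturbation_subset_MP :
  range dT `<=` range T -> nullspace T `<=` nullspace dT ->
  MP_metric_inverse (T \+ dT) Phi.
Proof.
move=> sR sN.
have TAdT x : T (A (dT x)) = dT x.
  by rewrite TA metric_proj_id//; apply: sR; exists x.
have TbarE x : (T \+ dT) x = T (x + A (dT x)).
  by rewrite (linear_add T_lin) TAdT.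
have TbarS x : (T \+ dT) (S x) = T x by rewrite TbarE SVK.
have eqR : range (T \+ dT) = range T.
  apply/seteqP; split=> _ [x _ <-].
    by exists (x + A (dT x)); rewrite // TbarE.
  by exists (S x) => //; rewrite TbarS.
have dTN x : dT (metric_proj (nullspace T) x) = 0.
  exact/sN/(metric_proj_mem _ NT_cheb).
have PhiTbar x : Phi ((T \+ dT) x) = x - metric_proj (nullspace T) x.
  rewrite PhiE /= A_dTD AT.
  (* Since [dT] kills the projection of [x], the sum takes the form [u + A (dT u)] with [u] the
     residual of [x], and [S] returns [u]. *)
  have -> : A (dT x) = A (dT (x - metric_proj (nullspace T) x)).
    by rewrite (zmod_morphism_linear dT_lin) dTN subr0.
  exact: SK.
have eqN : nullspace (T \+ dT) = nullspace T.
  apply/seteqP; split=> x; rewrite /nullspace /= => Tx.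
    (* As [Phi 0 = 0], a null vector of [T \+ dT] equals its own projection onto the null space of
       [T]. *)
    have := PhiTbar x; rewrite /= Tx PhiE A0 S0 => /esym/subr0_eq ->.
    exact: (metric_proj_mem _ NT_cheb).
  by have := sN x Tx; rewrite /nullspace /= => ->; rewrite Tx addr0.
have TbarPhi y : (T \+ dT) (Phi y) = metric_proj (range T) y.
  by rewrite PhiE TbarS TA.
split; rewrite ?eqR ?eqN //.
- apply/funext => x; rewrite /comp TbarPhi metric_proj_id// -eqR.
  by exists x.
- by apply/funext => y; rewrite /comp TbarPhi -TA !PhiE ATA.
- exact/funext.
- exact/funext.
Qed.

End perturbation.

Theorem theorem3p4 (R : realType) (X Y : completeNormedModType R)
    (X_smooth : smooth_space X) (Y_smooth : smooth_space Y)
    (T dT : X -> Y) (T_bounded : bounded_linear T) (T_closed : closed (range T))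
    (dT_bounded : bounded_linear dT)
    (NT_chebyshev : is_chebyshev (nullspace T))
    (NTbar_chebyshev : is_chebyshev (nullspace (T \+ dT)))
    (RT_chebyshev : is_chebyshev (range T))
    (RTbar_chebyshev : is_chebyshev (range (T \+ dT))) :
  (exists TM : Y -> X, MP_metric_inverse T TM) /\
  (forall TM : Y -> X, MP_metric_inverse T TM ->
    quasi_additive TM (range dT) ->
    invertible_B (id \+ (TM \o dT)) ->
    let Phi := TM \o inverse_map (id \+ (dT \o TM)) in
    [/\ invertible_H (id \+ (dT \o TM)),
        Phi = inverse_map (id \+ (TM \o dT)) \o TM &
        [<-> MP_metric_inverse (T \+ dT) Phi;
             range (T \+ dT) = range T /\
               nullspace (T \+ dT) = nullspace T;
             range dT `<=` range T /\ nullspace T `<=` nullspace dT]]).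
Proof.
split; first exact: MP_metric_inverse_exists.
move=> TM TM_MP TM_qadd inv Phi; split.
- exact: (perturbation_invertible T).
- exact: (perturbation_inverseE T).
- tfae.
  + exact: MP_perturbation_eq_spaces.
  + by case; exact: eq_spaces_perturbation_subset.
  + by case; exact: perturbation_subset_MP.
Qed.
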